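(* Let $K$ be a field, $S=K[x_1,\dots,x_n]$, $d\ge 2$, and ${\bf t}=(t_1,\dots,t_{d-1})$ a tuple of non-negative integers. Let $I\subseteq S$ be a ${\bf t}$-spread strongly stable ideal with minimal monomial generating set $G(I)=\{u_1>u_2>\dots>u_m\}$ ordered decreasingly with respect to the pure lexicographic order. For $k=1,\dots,m$ let $$\mathrm{set}(u_k)=\{i\in[n]: x_i\in(u_1,\dots,u_{k-1}):u_k\}.$$ Then for all $k=2,\dots,m$, $$\mathrm{set}(u_k)=[\max(u_k)-1]\setminus\mathrm{supp}_{\bf t}(u_k).$$
   Context: $S=K[x_1,\dots,x_n]$ is standard graded over a field $K$. Monomials are written $u=x_{j_1}x_{j_2}\cdots x_{j_\ell}$ with $1\le j_1\le j_2\le\cdots\le j_\ell\le n$. Such a monomial of degree $\ell\le d$ is called ${\bf t}$-spread if $j_{i+1}-j_i\ge t_i$ for $i=1,\dots,\ell-1$. A ${\bf t}$-spread monomial ideal is an ideal generated by ${\bf t}$-spread monomials. A ${\bf t}$-spread monomial ideal $I$ is ${\bf t}$-spread strongly stable if for every ${\bf t}$-spread monomial $u\in I$ and all $j<i$ such that $x_i$ divides $u$ and $x_j(u/x_i)$ is ${\bf t}$-spread, one has $x_j(u/x_i)\in I$. $G(I)$ denotes the unique minimal set of monomial generators of $I$. Pure lexicographic order: for distinct monomials, $x_1^{a_1}\cdots x_n^{a_n}>x_1^{b_1}\cdots x_n^{b_n}$ iff the leftmost non-zero entry of $(a_1-b_1,\dots,a_n-b_n)$ is positive. For a monomial $u\neq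 1$, $\max(u)$ is the largest $i$ such that $x_i$ divides $u$. For a positive integer $m$, $[m]=\{1,\dots,m\}$ (and $[0]=\emptyset$); for integers $j\le k$, $[j,k]=\{j,j+1,\dots,k\}$, and $[j,k]=\emptyset$ if $j>k$. The ${\bf t}$-spread support of a ${\bf t}$-spread monomial $u=x_{j_1}\cdots x_{j_\ell}$ is $$\mathrm{supp}_{\bf t}(u)=\bigcup_{i=1}^{\ell-1}[j_i,\,j_i+(t_i-1)].$$ *)

(* Defs.v *)
From mathcomp Require Import all_boot all_algebra.
From mathcomp Require Export mpoly.

Set Implicit Arguments.
Unset Strict Implicit.
Unset Printing Implicit Defensive.

Import GRing.Theory.
Local Open Scope ring_scope.

(* Indices are 0-based: i : 'I_n stands for the variable x_(i+1), and          *)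
(* nth 0 t p stands for t_(p+1).                                               *)

Section Ideals.
Variables (n : nat) (K : fieldType).
Implicit Types (J : {mpoly K[n]} -> Prop) (M : 'X_{1..n} -> Prop).

(* Ideals are Prop-valued predicates: the idealr structure of ring_quotient    *)
(* only covers proper ideals with a boolean membership test.                   *)
Definition ideal_gen (A : {mpoly K[n]} -> Prop) (p : {mpoly K[n]}) : Prop :=
  exists2 s : seq ({mpoly K[n]} * {mpoly K[n]}),
    forall x, x \in s -> A x.2 & p = \sum_(x <- s) x.1 * x.2.

Definition monomial_ideal M : {mpoly K[n]} -> Prop :=
  ideal_gen (fun p => exists2 v, M v & p = 'X_[v]).

Definition generates M J : Prop := forall p, J p <-> monomial_ideal M p.

Definition minimal_monomial_generators M J : Prop :=
  generates M J /\
  forall M' : 'X_{1..n} -> Prop,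
    (forall v, M' v -> M v) -> generates M' J -> forall v, M v -> M' v.

Definition colon J (f : {mpoly K[n]}) : {mpoly K[n]} -> Prop :=
  fun g => J (g * f).

End Ideals.

Section Monomials.
Variable n : nat.
Implicit Types u v : 'X_{1..n}.

Definition plex_gt u v : bool :=
  [exists i : 'I_n, (v i < u i)%N && [forall j : 'I_n, (j < i)%N ==> (u j == v j)]].

(* The (0-based) index of the p-th variable of u, where the variables of u are *)
(* listed with multiplicity in increasing order; meaningful for p < mdeg u.    *)
Definition var_index u (p : nat) : nat := nth 0%N [seq val i | i <- m2s u] p.

(* max(u), 0-based; meaningful for u distinct from the monomial 1 *)
Definition mnm_max u : nat := (\max_(i < n | u i != 0) i)%N.

Definition tspread d (t : d.-1.-tuple nat) u : Prop :=
  (mdeg u <= d)%N /\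
  forall p, (p.+1 < mdeg u)%N ->
    (var_index u p + nth 0 t p <= var_index u p.+1)%N.

(* [j, j + (t - 1)] is the half-open interval [j, j + t), empty when t = 0.    *)
Definition tsupp d (t : d.-1.-tuple nat) u : {set 'I_n} :=
  \bigcup_(p < (mdeg u).-1)
    [set i : 'I_n | (var_index u p <= i < var_index u p + nth 0 t p)%N].

(* x_j (u / x_i), for x_i dividing u *)
Definition exchange u (i j : 'I_n) : 'X_{1..n} := (U_(j) + (u - U_(i)))%MM.

End Monomials.

Section StronglyStable.
Variables (n : nat) (K : fieldType) (d : nat) (t : d.-1.-tuple nat).
Implicit Type J : {mpoly K[n]} -> Prop.

Definition tspread_ideal J : Prop :=
  exists2 M : 'X_{1..n} -> Prop, forall v, M v -> tspread t v & generates M J.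

Definition tspread_strongly_stable J : Prop :=
  tspread_ideal J /\
  forall (u : 'X_{1..n}) (i j : 'I_n),
    tspread t u -> J 'X_[u] -> (j < i)%N -> u i != 0%N ->
    tspread t (exchange u i j) -> J 'X_[exchange u i j].

End StronglyStable.

(* set(u_k) for an ordered list u of monomials: the indices of the variables   *)
(* in (u_1, ..., u_(k-1)) : u_k, where take k u lists the generators before    *)
(* the one at (0-based) position k.                                            *)
Definition colon_vars n (K : fieldType) m (u : m.-tuple 'X_{1..n}) (k : 'I_m)
    (i : 'I_n) : Prop :=
  colon (monomial_ideal (K := K) (fun v => v \in take k u)) 'X_[tnth u k] 'X_i.

(* Main.v *)
(* If u_l divides x_i u_k with u_l > u_k, then u_l agrees with u_k below i and *)
(* contains x_i once more, so t-spreadness of u_l forbids i in supp_t(u_k),    *)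
(* and i < max(u_k) since u_k does not divide u_l. Conversely, for i in the    *)
(* right-hand side, replacing by x_i the first variable of u_k after x_i gives *)
(* a t-spread monomial v of I. A degree-e generator dividing v dominates the   *)
(* length-e prefix of v index by index, which therefore lies in I; hence the   *)
(* shortest prefix of v in I is a generator. As it does not properly divide    *)
(* u_k, it contains the new x_i, so it divides x_i u_k and exceeds u_k.        *)
Require Import Defs.
From mathcomp Require Import all_boot all_algebra.
From mathcomp Require Import zify.

Set Implicit Arguments.
Unset Strict Implicit.
Unset Printing Implicit Defensive.

Import GRing.Theory.

(** Write g for u_k. As x_i g is a monomial, i lies in set(g) exactly when some generator w above g
    in the lexicographic order divides x_i g ([monomial_idealX], [take_sorted_plex]). The rest
    concerns sorted lists of variable indices, compared through the number of variables of index at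
    most b ([var_index_leq]). Such a w is, up to index i, the monomial g with one more x_i. If i
    fell in the t-spread support, after the q-th variable of g, the variables q and q+1 of w would
    be too close ([colon_plex_gt]). The converse, [generator_in_colon], rests on a Borel-type
    property: membership in I survives lowering the indices of a t-spread monomial termwise, as long
    as the result is t-spread ([spread_seq_stable]). This yields both the monomial v in I and, by
    [prefix_generator], a generator among its prefixes. *)

Section Ideals.
Variables (n : nat) (K : fieldType).
Implicit Types (A B J : {mpoly K[n]} -> Prop) (M : 'X_{1..n} -> Prop).
Local Open Scope ring_scope.

(** * Monomials in monomial ideals, and minimal generators *)

Lemma ideal_gen_sub A B p :
  (forall a, A a -> ideal_gen B a) -> ideal_gen A p -> ideal_gen B p.
Proof.
move=> AB [s sA ->]; elim: s sA => [|x s IHs] sA; first by exists [::].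
have [r rB rE] := AB _ (sA x (mem_head _ _)).
have [|r' r'B r'E] := IHs; first by move=> y ys; apply: sA; rewrite inE ys orbT.
exists ([seq (x.1 * y.1, y.2) | y <- r] ++ r') => [y|].
  by rewrite mem_cat => /orP[/mapP[z /rB zB ->] //|/r'B].
rewrite big_cons big_cat big_map -r'E rE mulr_sumr; congr (_ + _).
by apply: eq_bigr => y _; rewrite mulrA.
Qed.

Lemma monomial_idealX M v :
  monomial_ideal (K := K) M 'X_[v] <-> exists2 w, M w & (w <= v)%MM.
Proof.
split=> [[s sM vE]|[w Mw wv]]; last first.
  exists [:: ('X_[v - w], 'X_[w])]; last by rewrite big_seq1 /= -mpolyXD submK.
  by move=> x; rewrite inE => /eqP ->; exists w.
(* The coefficient of ['X_[v]] in the whole sum is 1, so some summand contributes to it. *)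
have [x xs xv] : exists2 x, x \in s & (x.1 * x.2)@_v != 0.
  apply/hasP; apply/negPn/negP => /hasPn s0.
  have := mcoeffX K v v; rewrite eqxx vE raddf_sum big_seq big1.
    by move/eqP; rewrite eq_sym oner_eq0.
  by move=> x /s0 /negPn /eqP.
have [w Mw xE] := sM x xs; exists w => //; rewrite xE in xv.
have : v \in msupp (x.1 * 'X_[w]) by rewrite mcoeff_msupp.
by move/msuppM_le/allpairsP=> [[a b] /= [_]]; rewrite msuppX inE => /eqP -> ->;
  exact: lem_addl.
Qed.

(** If v divided a different generator w, deleting w would leave a generating set, against
    minimality. *)
Lemma minimal_generators_leq M J v w :
  minimal_monomial_generators M J -> M v -> M w -> (v <= w)%MM -> v = w.
Proof.
move=> [gJ minM] Mv Mw vw; apply/eqP/negPn/negP => vNw.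
suff [_ /(_ (erefl w))] : M w /\ w <> w by [].
apply: (minM (fun x => M x /\ x <> w)) => // [x []//|p]; rewrite (gJ p).
split; apply: ideal_gen_sub => _ [x Mx ->].
  apply/monomial_idealX; case: (eqVneq x w) => [->|xw].
    by exists v => //; split=> //; apply/eqP.
  by exists x; [split=> //; apply/eqP|exact: lepm_refl].
by apply/monomial_idealX; exists x; [case: Mx|exact: lepm_refl].
Qed.

Lemma generatesX M J v :
  generates M J -> J 'X_[v] <-> exists2 w, M w & (w <= v)%MM.
Proof. by move=> gJ; rewrite (gJ 'X_[v]); exact: monomial_idealX. Qed.

(** Dividing v by an element of [M'], and that one by an element of [M], must give back v. Applied
    to a generating set of t-spread monomials, this makes the minimal generators t-spread. *)
Lemma minimal_generators_sub M M' J v :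
  minimal_monomial_generators M J -> generates M' J -> M v -> M' v.
Proof.
move=> minM gM' Mv; have [gM _] := minM.
have /(generatesX v gM')[w M'w wv] : J 'X_[v].
  by apply/(generatesX v gM); exists v => //; exact: lepm_refl.
have /(generatesX w gM)[x Mx xw] : J 'X_[w].
  by apply/(generatesX w gM'); exists w => //; exact: lepm_refl.
have xv := minimal_generators_leq minM Mx Mv (lepm_trans xw wv).
suff <- : w = v by [].
apply/mnmP => i; apply/eqP; rewrite eqn_leq (mnm_lepP wv i) -xv.
exact: (mnm_lepP xw i).
Qed.

End Ideals.

(** * Lexicographic order, and monomials as sorted lists of indices *)

Section Monomials.
Variable n : nat.
Implicit Types (u v w : 'X_{1..n}) (s : seq 'I_n).

Lemma plex_gtP u v :
  reflect (exists i : 'I_n, v i < u i /\ forall j : 'I_n, j < i -> u j = v j)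
          (plex_gt u v).
Proof.
apply: (iffP existsP) => [[i /andP[vu /forallP uv]]|[i [vu uv]]]; exists i.
  by split=> // j ji; apply/eqP; move: (uv j); rewrite ji.
by rewrite vu; apply/forallP => j; apply/implyP => /uv ->.
Qed.

Lemma plex_gt_irr : irreflexive (@plex_gt n).
Proof. by move=> u; apply/plex_gtP => -[i []]; rewrite ltnn. Qed.

Lemma plex_gt_trans : transitive (@plex_gt n).
Proof.
move=> v u w /plex_gtP[i [vui uvi]] /plex_gtP[j [wvj vwj]]; apply/plex_gtP.
case: (ltngtP i j) => [ij|ji|/val_inj ij].
- exists i; split=> [|l li]; first by rewrite -vwj.
  by rewrite uvi // vwj // (ltn_trans li).
- exists j; split=> [|l lj]; first by rewrite uvi.
  by rewrite uvi ?vwj // (ltn_trans lj).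
- subst j; exists i; split=> [|l li]; first exact: ltn_trans vui.
  by rewrite uvi ?vwj.
Qed.

Lemma take_sorted_plex (r : seq 'X_{1..n}) k v :
  sorted (@plex_gt n) r -> k < size r ->
  v \in take k r = (v \in r) && plex_gt v (nth v r k).
Proof.
move=> sr kr; apply/idP/andP => [|[vr]].
  move=> vk; split; first exact: mem_take vk.
  have /(nthP v)[l] := vk; rewrite size_take kr => lk; rewrite nth_take // => <-.
  rewrite (set_nth_default (nth v r l)) //.
  rewrite [X in plex_gt _ X](set_nth_default v) //.
  by apply: (sorted_ltn_nth plex_gt_trans) => //; rewrite inE // (ltn_trans lk).
have /(nthP v)[l lr <-] := vr; case: (ltnP l k) => [lk _|].
  by rewrite -(nth_take v lk) mem_nth // size_take kr.
rewrite leq_eqVlt => /orP[/eqP <-|kl].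
  by rewrite (set_nth_default v) // plex_gt_irr.
rewrite (set_nth_default v) // => gt_lk.
have gt_kl := sorted_ltn_nth plex_gt_trans v sr k l kr lr kl.
by have := plex_gt_trans gt_lk gt_kl; rewrite plex_gt_irr.
Qed.

Lemma count_mem_m2s u i : count_mem i (m2s u) = u i.
Proof. by rewrite -[in RHS](s2mK u) mnmE. Qed.

Lemma m2sK s : sorted leq (map val s) -> m2s (s2m s) = s.
Proof.
move=> ss; apply: (inj_map val_inj).
apply: (sorted_eq leq_trans anti_leq) => //; first exact: srt_m2s.
by apply/perm_map/allP => i _ /=; rewrite count_mem_m2s mnmE.
Qed.

Lemma mdeg_s2m s : mdeg (s2m s) = size s.
Proof.
rewrite -size_m2s; apply: perm_size; apply/allP => i _ /=.
by rewrite count_mem_m2s mnmE.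
Qed.

Lemma count_m2s (a : pred 'I_n) u : count a (m2s u) = \sum_(i | a i) u i.
Proof.
rewrite /m2s count_flatten -map_comp sumnE big_map big_enum /= [RHS]big_mkcond.
by apply: eq_bigr => i _ /=; rewrite count_nseq; case: (a i); rewrite ?mul1n.
Qed.

Lemma nth_sorted_leq (r : seq nat) q b :
  sorted leq r -> q < size r -> (nth 0 r q <= b) = (q < count (geq b) r).
Proof.
elim: r q => //= x r IHr q; rewrite path_sortedE; last exact: leq_trans.
move=> /andP[/allP xr sr].
case: (leqP x b) => [xb|bx]; case: q => [|q] //= qr.
- by rewrite add1n ltnS IHr.
- suff -> : count (geq b) r = 0 by rewrite leqNgt bx.
  apply/eqP; rewrite -leqn0 leqNgt -has_count; apply/hasPn => y /xr /=.
  by move/(leq_trans bx); rewrite -ltnNge.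
- suff -> : count (geq b) r = 0.
    by apply/negbTE; rewrite -ltnNge (leq_trans bx) // xr // mem_nth.
  apply/eqP; rewrite -leqn0 leqNgt -has_count; apply/hasPn => y /xr /=.
  by move/(leq_trans bx); rewrite -ltnNge.
Qed.

(** Turns positions in the sorted list into sums of exponents, on which divisibility and equality of
    exponents act directly. *)
Lemma var_index_leq u q b :
  q < mdeg u -> (var_index u q <= b) = (q < \sum_(i : 'I_n | i <= b) u i).
Proof.
move=> qu; rewrite nth_sorted_leq ?srt_m2s ?size_map ?size_m2s // count_map.
by rewrite (count_m2s (preim val (geq b))).
Qed.

Lemma lem_mdeg u v : (u <= v)%MM -> mdeg u <= mdeg v.
Proof. by move=> /mnm_lepP uv; rewrite !mdegE; apply: leq_sum. Qed.

Lemma lem_var_index u v q :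
  (u <= v)%MM -> q < mdeg u -> var_index v q <= var_index u q.
Proof.
move=> uv qu; have qv := leq_trans qu (lem_mdeg uv).
rewrite var_index_leq //.
rewrite (@leq_trans (\sum_(i : 'I_n | i <= var_index u q) u i)) //.
  by rewrite -var_index_leq.
by apply: leq_sum => i _; exact: (mnm_lepP uv i).
Qed.

End Monomials.

(** * Termwise lowering of t-spread monomials, and prefixes that are generators *)

Section StronglyStable.
Variables (n d : nat) (t : d.-1.-tuple nat).
Implicit Types (u v w : 'X_{1..n}) (a b s : seq 'I_n).

Let idx s p := nth 0 [seq val i | i <- s] p.

Definition spread_seq s : Prop :=
  size s <= d /\ forall p, p.+1 < size s -> idx s p + nth 0 t p <= idx s p.+1.

Lemma spread_seq_sorted s : spread_seq s -> sorted leq [seq val i | i <- s].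
Proof.
move=> [_ ts]; apply/(sortedP 0) => p; rewrite size_map => /ts.
by apply: leq_trans; exact: leq_addr.
Qed.

Lemma spread_seqP s : spread_seq s -> tspread t (s2m s).
Proof.
move=> ts; have sK := m2sK (spread_seq_sorted ts).
by rewrite /tspread /var_index sK mdeg_s2m.
Qed.

Lemma tspread_m2s u : tspread t u -> spread_seq (m2s u).
Proof. by rewrite /spread_seq size_m2s. Qed.

Lemma spread_seq_take s e : spread_seq s -> spread_seq (take e s).
Proof.
move=> [sd ts].
have se : size (take e s) <= size s by rewrite size_take_min geq_minr.
split=> [|p ps]; first exact: leq_trans se sd.
have pe : p.+1 < e by move: ps; rewrite size_take_min; lia.
by rewrite /idx map_take !nth_take ?ts //; lia.
Qed.

(** The only new gap is at the junction, where the left entry, coming from [a], is at most the entry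
    of [b] it replaces. *)
Lemma spread_seq_splice a b q :
  spread_seq a -> spread_seq b -> size a = size b ->
  (forall p, p < size b -> idx a p <= idx b p) ->
  q <= size b -> spread_seq (take q a ++ drop q b).
Proof.
move=> [ad ta] [_ tb] ab le_ab qb.
have sE : size (take q a ++ drop q b) = size b.
  by rewrite size_cat size_takel ?ab // size_drop subnKC.
have iE p : idx (take q a ++ drop q b) p = if p < q then idx a p else idx b p.
  rewrite /idx map_cat map_take map_drop nth_cat size_takel ?size_map ?ab //.
  by case: ltnP => pq; rewrite ?nth_take // nth_drop subnKC.
split=> [|p]; rewrite sE ?iE -?ab // => pa.
have := ta p pa; have := tb p; have := le_ab p; rewrite -!ab.
by case: (ltnP p q); case: (ltnP p.+1 q); lia.
Qed.

Section Ideal.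
Variables (K : fieldType) (J : {mpoly K[n]} -> Prop).

Lemma minimal_generators_tspread (M : 'X_{1..n} -> Prop) u :
  tspread_ideal t J -> minimal_monomial_generators M J -> M u -> tspread t u.
Proof.
move=> [M' tM' gM'] minM Mu.
by apply: tM'; exact: minimal_generators_sub minM gM' Mu.
Qed.

Hypothesis stJ : tspread_strongly_stable t J.

(** The entries of [b] are replaced by those of [a] from left to right. Each replacement is trivial
    or a single exchange, and all intermediate monomials are t-spread by [spread_seq_splice]. *)
Lemma spread_seq_stable a b :
  spread_seq a -> spread_seq b -> size a = size b ->
  (forall p, p < size b -> idx a p <= idx b p) ->
  J 'X_[s2m b] -> J 'X_[s2m a].
Proof.
move=> ta tb ab le_ab Jb.
suff Jq q : q <= size b -> J 'X_[s2m (take q a ++ drop q b)].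
  by have := Jq _ (leqnn _); rewrite drop_size cats0 -ab take_size.
elim: q => [_|q IHq qb]; first by rewrite take0 drop0.
have tq := spread_seq_splice ta tb ab le_ab (ltnW qb).
have tq1 := spread_seq_splice ta tb ab le_ab qb.
have x0 : 'I_n by case: (b) qb => // x.
move: (IHq (ltnW qb)) tq tq1 (le_ab q qb).
rewrite (drop_nth x0 qb) (take_nth x0) ?ab // cat_rcons /idx.
rewrite !(nth_map x0) ?ab //.
move: (nth x0 a q) (nth x0 b q) (take q a) (drop _ b) => x y l r Jy ty tx.
rewrite leq_eqVlt => /orP[/eqP/val_inj -> //|xy].
have xE : s2m (l ++ x :: r) = exchange (s2m (l ++ y :: r)) y x.
  by apply/mnmP => z; rewrite !(mnmE, mnm1E, count_cat) /=; lia.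
rewrite xE; apply: stJ.2 => //; first exact: spread_seqP.
  by rewrite mnmE count_cat /= eqxx; lia.
by rewrite -xE; exact: spread_seqP.
Qed.

(* Any prefix of a t-spread monomial is t-spread, whereas a divisor need not   *)
(* be: this is why generators dividing v are traded for prefixes of v.         *)
Lemma prefix_generator (G : seq 'X_{1..n}) v :
  minimal_monomial_generators (fun w => w \in G) J ->
  tspread t v -> J 'X_[v] -> exists e, s2m (take e (m2s v)) \in G.
Proof.
move=> minG tv Jv; have [gG _] := minG.
pose pre e := s2m (take e (m2s v)).
(* A boolean membership test for monomials, so that a shortest prefix in the ideal can be chosen. *)
have JP w : reflect (J 'X_[w]) (has (fun g => (g <= w)%MM) G).
  by apply: (iffP hasP) => /(generatesX w gG).
have exe : exists e, has (fun g => (g <= pre e)%MM) G.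
  by exists (mdeg v); apply/JP; rewrite /pre -size_m2s take_size s2mK.
have [e Je mine] := ex_minnP exe; exists e; rewrite -/(pre e).
have /hasP[g gG' ge] := Je.
(* A divisor of [pre e] of degree at least e is [pre e] itself. *)
suff eg : e <= mdeg g.
  suff <- : g = pre e by [].
  apply/mnmP => i; apply/eqP; rewrite eqn_leq (mnm_lepP ge i) /=.
  have: \sum_j g j >= \sum_j pre e j.
    rewrite -!mdegE (leq_trans _ eg) // mdeg_s2m size_take_min geq_minl //.
  rewrite leqNgt; apply: contraR; rewrite -ltnNge => gi.
  rewrite [X in X < _](bigD1 i) //= [X in _ < X](bigD1 i) //= -addSn.
  by rewrite leq_add // leq_sum // => j _; exact: (mnm_lepP ge j).
(* By minimality of e it suffices that the prefix of length [mdeg g] lies in the ideal; it is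
   termwise at most g because g divides v. *)
apply: mine; apply/JP.
have gv : (g <= v)%MM.
  apply: lepm_trans ge _; apply/mnm_lepP => i.
  by rewrite mnmE -count_mem_m2s -{2}(cat_take_drop e (m2s v)) count_cat leq_addr.
have tg : tspread t g by exact: minimal_generators_tspread stJ.1 minG gG'.
have sg : size (take (mdeg g) (m2s v)) = mdeg g.
  by rewrite size_takel // size_m2s lem_mdeg.
apply: (@spread_seq_stable _ (m2s g)).
- by apply: spread_seq_take; exact: tspread_m2s.
- exact: tspread_m2s.
- by rewrite sg size_m2s.
- move=> p; rewrite size_m2s => pg.
  by rewrite /idx map_take nth_take // lem_var_index.
- by rewrite s2mK; apply/(generatesX g gG); exists g => //; exact: lepm_refl.
Qed.

End Ideal.
End StronglyStable.

(** * The two inclusions *)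

Section Colon.
Variables (n d : nat) (t : d.-1.-tuple nat).
Implicit Types (g w : 'X_{1..n}) (i j : 'I_n).

Lemma mnm_maxP g i : reflect (exists2 j : 'I_n, i < j & g j != 0) (i < mnm_max g).
Proof.
apply: (iffP idP) => [|[j ij gj]]; last first.
  apply: leq_trans ij _.
  exact: (leq_bigmax_cond (F := fun j : 'I_n => j : nat)).
move=> ig; have /existsP[j /andP[? ?]] : [exists j : 'I_n, (i < j) && (g j != 0)].
  apply: contraLR ig => /existsPn ng; rewrite -leqNgt; apply/bigmax_leqP => j gj.
  by rewrite leqNgt; have := ng j; rewrite gj andbT.
by exists j.
Qed.

Lemma tsuppP g i :
  reflect (exists2 p, p.+1 < mdeg g &
             var_index g p <= i < var_index g p + nth 0 t p) (i \in tsupp t g).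
Proof.
apply: (iffP bigcupP) => [[p _]|[p pg]]; rewrite ?inE => ip.
  by exists p => //; have := ltn_ord p; lia.
have pg' : p < (mdeg g).-1 by lia.
by exists (Ordinal pg') => //; rewrite inE.
Qed.

Lemma colon_plex_gt g w i :
  tspread t w -> (w <= U_(i) + g)%MM -> ~ (w <= g)%MM -> ~ (g <= w)%MM ->
  plex_gt w g -> i < mnm_max g /\ i \notin tsupp t g.
Proof.
move=> tw /mnm_lepP wig wNg gNw /plex_gtP[a [wa wE]].
have wj j : j != i -> w j <= g j.
  by move=> ji; have := wig j; rewrite mnmDE mnm1E eq_sym (negbTE ji).
(* As w divides x_i g, its exponent can exceed that of g only at i. *)
have ai : a = i by apply/eqP; apply: contraLR wa => /wj; rewrite -leqNgt.
subst a; have wi : w i = (g i).+1.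
  by have := wig i; rewrite mnmDE mnm1E eqxx; lia.
have cE : \sum_(j : 'I_n | j <= i) w j = (\sum_(j : 'I_n | j <= i) g j).+1.
  rewrite (bigD1 i) //= [in RHS](bigD1 i) //= wi -addSn; congr (_ + _).
  by apply: eq_bigr => j /andP[ji jNi]; apply: wE; rewrite ltn_neqAle jNi.
have cw : \sum_(j : 'I_n | j <= i) w j <= mdeg w.
  by rewrite mdegE [X in _ <= X](bigID (fun j : 'I_n => j <= i)) leq_addr.
split.
  apply/negPn/negP => /mnm_maxP ig; apply: gNw; apply/mnm_lepP => j.
  case: (ltngtP j i) => [/wE ->//|ij|/val_inj ->]; last by rewrite wi.
  by case: (eqVneq (g j) 0) => [->//|gj]; case: ig; exists j.
apply/negP => /tsuppP[q qg /andP[qi iq]].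
have qc : q.+1 < \sum_(j : 'I_n | j <= i) w j.
  by rewrite cE ltnS -var_index_leq //; exact: ltnW.
have qw : q.+1 < mdeg w by exact: leq_trans cw.
have wq : var_index w q.+1 <= i by rewrite var_index_leq.
(* Writing g_q and w_q for the variable indices, this closes the contradictory chain i >= w_(q+1) >=
   w_q + t_q >= g_q + t_q > i. *)
have := tw.2 q qw; suff: var_index g q <= var_index w q by lia.
case: (leqP i (var_index w q)) => [|wqi]; first exact: leq_trans.
rewrite var_index_leq; last exact: ltnW.
rewrite (@leq_trans (\sum_(j : 'I_n | j <= var_index w q) w j)) //.
  by rewrite -var_index_leq // ltnW.
by apply: leq_sum => j jw; rewrite wE // (leq_ltn_trans jw).
Qed.

Lemma generator_in_colon (K : fieldType) (I : {mpoly K[n]} -> Prop)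
    (G : seq 'X_{1..n}) g i :
  tspread_strongly_stable t I ->
  minimal_monomial_generators (fun w => w \in G) I -> g \in G ->
  i < mnm_max g -> i \notin tsupp t g ->
  exists w, [/\ w \in G, (w <= U_(i) + g)%MM & plex_gt w g].
Proof.
move=> stI minG gG ig iNsupp; have [gI _] := minG.
have tg : tspread t g by exact: minimal_generators_tspread stI.1 minG gG.
have Ig : I 'X_[g] by apply/(generatesX g gI); exists g => //; exact: lepm_refl.
(* The number of variables of g up to x_i, hence the 0-based position of the first one after x_i. *)
set p := \sum_(j : 'I_n | j <= i) g j.
have pg : p < mdeg g.
  have [j ij gj] := mnm_maxP g i ig.
  rewrite mdegE [X in _ < X](bigID (fun j : 'I_n => j <= i)) /= -/p.
  by rewrite -[X in X < _]addn0 ltn_add2l (bigD1 j) -?ltnNge //= addn_gt0 lt0n gj.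
have var_le q : q < mdeg g -> (var_index g q <= i) = (q < p).
  by move=> qg; rewrite var_index_leq.
pose s := m2s g; have ss : size s = mdeg g by exact: size_m2s.
(* v = x_i (g / x_j) for the first variable x_j of g after x_i *)
pose l := set_nth i s p i; have sl : size l = mdeg g.
  by rewrite size_set_nth ss; apply/maxn_idPr.
have nth_s q : q < mdeg g -> nth i s q = var_index g q :> nat.
  by move=> qg; rewrite /var_index (nth_map i) ?ss.
have nth_l q : q < mdeg g -> 
      nth 0 (map val l) q = if q == p then i : nat else var_index g q.
  move=> qg; rewrite (nth_map i) ?sl // nth_set_nth /=.
  by case: eqP => // _; exact: nth_s.
have tl : spread_seq t l.
  split=> [|q]; rewrite sl; first exact: tg.1.
  move=> qg; rewrite !nth_l //; last exact: ltnW.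
  have tq := tg.2 q qg; have := var_le q (ltnW qg); have := var_le q.+1 qg.
  (* Only two gaps change. The one after position p widens; the one before it is wide enough because
     i avoids the support. *)
  case: (eqVneq q p) => [qp|qp]; first by case: eqP; lia.
  case: (eqVneq q.+1 p) => [qp1 _|_ _ _ //]; rewrite -qp1 ltnSn => qi.
  rewrite leqNgt; apply: contra iNsupp => iq.
  by apply/tsuppP; exists q; rewrite ?qi.
have Iv : I 'X_[s2m l].
  apply: (spread_seq_stable stI (b := m2s g)) => //.
  - exact: tspread_m2s.
  - by rewrite sl size_m2s.
  - move=> q; rewrite size_m2s => qg; rewrite nth_l //; case: eqP => [->|//].
    have := var_le p pg; rewrite ltnn; rewrite /var_index; lia.
  - by rewrite s2mK.
have [e] := prefix_generator stI minG (spread_seqP tl) Iv.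
rewrite m2sK; last exact: spread_seq_sorted tl.
set w := s2m _ => wG; exists w.
have lE : l = take p s ++ i :: drop p.+1 s by rewrite /l set_nthE ss pg.
have count_l z : count_mem z l = g z + (i == z) - (nth i s p == z).
  by rewrite count_set_nth_ltn ?ss //= /s count_mem_m2s.
(* If e <= p, the prefix stops before the new x_i and divides g, so it equals g by minimality,
   although its degree is at most p < [mdeg g]. *)
case: (leqP e p) => [ep|pe].
  have wE : w = s2m (take e s).
    have sp : size (take p s) = p by rewrite size_takel // ss ltnW.
    by rewrite /w lE takel_cat ?sp // take_takel.
  have wg : (w <= g)%MM.
    apply/mnm_lepP => z.
    rewrite wE mnmE -count_mem_m2s -{1}(cat_take_drop e (m2s g)).
    by rewrite count_cat leq_addr.
  have wgE := minimal_generators_leq minG wG gG wg.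
  by move: pg; rewrite -wgE wE mdeg_s2m size_take_min; lia.
have wl z : w z <= count_mem z l.
  by rewrite mnmE -{2}(cat_take_drop e l) count_cat leq_addr.
split=> //.
  by apply/mnm_lepP => z; have := wl z; rewrite mnmDE mnm1E count_l; lia.
(* The entries cut off lie at positions beyond p, where all indices exceed i, so no variable up to
   x_i is lost. *)
have wE (z : 'I_n) : z <= i -> w z = g z + (i == z).
  move=> zi; have -> : g z + (i == z) = count_mem z l.
    rewrite count_l (_ : (nth i s p == z) = false) ?subn0 //.
    apply: contraTF zi => /eqP <-; rewrite nth_s // -ltnNge.
    by rewrite ltnNge var_le // ltnn.
  rewrite -{1}(cat_take_drop e l) count_cat mnmE.
  suff /count_memPn -> : z \notin drop e l by rewrite addn0.
  apply/negP => /(nthP i)[r]; rewrite size_drop sl nth_drop => rl rz.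
  have er : e + r < mdeg g by lia.
  have := nth_l (e + r) er; rewrite (nth_map i) ?sl // rz.
  have := var_le (e + r) er; case: eqP => /=; lia.
apply/plex_gtP; exists i; split=> [|j ji].
  by rewrite wE // eqxx addn1.
rewrite wE ?(ltnW ji) // (_ : (i == j) = false) ?addn0 //.
by apply: contraTF ji => /eqP ->; rewrite ltnn.
Qed.

End Colon.

Theorem corollary2p3 (K : fieldType) (n d : nat) (hd : (2 <= d)%N)
    (t : d.-1.-tuple nat)
    (I : {mpoly K[n]} -> Prop) (hI : tspread_strongly_stable t I)
    (m : nat) (u : m.-tuple 'X_{1..n})
    (hG : minimal_monomial_generators (fun v => v \in u) I)
    (hu : sorted (@plex_gt n) u)
    (k : 'I_m) (hk : (0 < k)%N) :
  forall i : 'I_n,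
    colon_vars K u k i <->
    i \in [set j : 'I_n | (j < mnm_max (tnth u k))%N] :\: tsupp t (tnth u k).
Proof.
move=> i; set g := tnth u k.
have gu : g \in u by exact: mem_tnth.
have take_uE v : v \in take k u = (v \in u) && plex_gt v g.
  by rewrite take_sorted_plex ?size_tuple // /g (tnth_nth v).
have colonE : colon_vars K u k i <->
    exists2 w, w \in take k u & (w <= U_(i) + g)%MM.
  by rewrite -(monomial_idealX K) mpolyXD.
rewrite colonE !inE; split=> [[w]|/andP[iNsupp ig]].
  rewrite take_uE => /andP[wu gt_w] wig.
  (* Distinct minimal generators do not divide each other, which supplies the two non-divisibility
     conditions. *)
  have wNg : w <> g by move=> wg; rewrite wg plex_gt_irr in gt_w.
  have [|||-> ->//] := colon_plex_gt (t := t) _ wig _ _ gt_w.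
  - exact: minimal_generators_tspread hI.1 hG wu.
  - by move/(minimal_generators_leq hG wu gu).
  - by move/(minimal_generators_leq hG gu wu)/esym.
have [w [wu wig gt_w]] := generator_in_colon hI hG gu ig iNsupp.
by exists w => //; rewrite take_uE wu.
Qed.
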